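(* Let $ABCD$ be a cyclic quadrilateral in the Euclidean plane with four distinct vertices on a circle $\Gamma$, and let $\Sigma$ be a (non-degenerate) rectangular hyperbola passing through $A,B,C,D$. Let $P$ be a point of $\Sigma$ different from $A,B,C,D$. Let $A',B',C',D'$ be the second intersections of the lines $AP,BP,CP,DP$ with $\Gamma$, and let $Pg_1,Pg_2,Pg_3,Pg_4$ be the isogonal conjugates of $P$ with respect to the triangles $BCD$, $ACD$, $ABD$, $ABC$ respectively. Then the quadrilateral $Pg_1Pg_2Pg_3Pg_4$ is similar to the quadrilateral $A'B'C'D'$, with vertices corresponding in the order written (that is, the ratio of corresponding distances is the same for all six pairs of corresponding vertices).
   Context: A rectangular hyperbola is a hyperbola whose asymptotes are perpendicular. If a line through a point $S$ of $\Gamma$ is tangent to $\Gamma$ at $S$, its second intersection with $\Gamma$ is $S$ itself. The isogonal conjugate of a point $P$ (not on the circumcircle or side lines) with respect to a triangle $XYZ$ is the common point of the three lines obtained by reflecting $XP,YP,ZP$ in the internal angle bisectors of the triangle at $X,Y,Z$ respectively. The symbols $Pg_k$ denote single points. *)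

(* Defs.v *)
From HB Require Import structures.
From mathcomp Require Import all_boot all_order all_algebra.
From mathcomp Require Import boolp classical_sets reals.

Set Implicit Arguments.
Unset Strict Implicit.
Unset Printing Implicit Defensive.

Import Order.TTheory GRing.Theory Num.Theory.

Local Open Scope classical_set_scope.
Local Open Scope ring_scope.

Section EuclideanPlane.
Variable R : realType.

(* The Euclidean plane is 'rV[R]_2.  The norm that mathcomp-analysis puts on
   matrices is the sup norm, hence the separate definition of enorm. *)
Notation plane := 'rV[R]_2.
Implicit Types (M O P Q S T X Y Z u v : plane) (Sigma L : set plane).

Definition dot u v : R := \sum_(i < 2) u 0 i * v 0 i.

Definition enorm u : R := Num.sqrt (dot u u).

Definition edist X Y : R := enorm (Y - X).

Definition circle O (r : R) : set plane := [set M | edist O M = r].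

(* A line when u != 0. *)
Definition line X u : set plane := [set M | exists t : R, M = X + t *: u].

Definition line_through X Y : set plane := line X (Y - X).

Definition tangent_at L (Gamma : set plane) S : Prop :=
  L `&` Gamma = [set S].

Definition second_intersection (Gamma : set plane) S P S' : Prop :=
  [/\ line_through S P S', Gamma S' &
      S' <> S \/ (S' = S /\ tangent_at (line_through S P) Gamma S)].

(* Canonical equation in the orthonormal frame (O; u, v); such a conic is
   non-degenerate because a and b are positive. *)
Definition hyperbola Sigma : Prop :=
  exists O u v (a b : R),
    [/\ dot u u = 1, dot v v = 1 & dot u v = 0] /\
    [/\ 0 < a, 0 < b &
        Sigma = [set M | (dot (M - O) u / a) ^+ 2
                         - (dot (M - O) v / b) ^+ 2 = 1]].

(* L is approached arbitrarily closely by points of Sigma arbitrarily far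
   away; a hyperbola has exactly two such lines. *)
Definition asymptote Sigma L : Prop :=
  forall eps K : R, 0 < eps ->
    exists M T, [/\ Sigma M, L T, K < enorm M & edist M T < eps].

Definition rectangular_hyperbola Sigma : Prop :=
  hyperbola Sigma /\
  exists X u Y v,
    [/\ u <> 0, v <> 0, asymptote Sigma (line X u), asymptote Sigma (line Y v)
      & dot u v = 0].

(* Reflection in the line through X directed by u != 0. *)
Definition reflection X u M : plane :=
  X + (2 * dot (M - X) u / dot u u) *: u - (M - X).

(* Directs the internal bisector at X of the triangle XYZ. *)
Definition bisector_dir X Y Z : plane :=
  (edist X Y)^-1 *: (Y - X) + (edist X Z)^-1 *: (Z - X).

Definition isogonal_line X Y Z P : set plane :=
  reflection X (bisector_dir X Y Z) @` line_through X P.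

(* For P outside the circumcircle and the side lines of the triangle XYZ,
   exactly one point Q satisfies this. *)
Definition isogonal_conjugate X Y Z P Q : Prop :=
  [/\ isogonal_line X Y Z P Q, isogonal_line Y Z X P Q
    & isogonal_line Z X Y P Q].

Definition similar_polygons n (V W : n.-tuple plane) : Prop :=
  exists2 k : R, 0 < k &
    forall i j : 'I_n,
      edist (tnth V i) (tnth V j) = k * edist (tnth W i) (tnth W j).

End EuclideanPlane.

(* Main.v *)
Require Import Defs.
From HB Require Import structures.
From mathcomp Require Import all_boot all_order all_algebra.
From mathcomp Require Import boolp classical_sets reals.
From mathcomp Require Import complex ring.

Import Order.TTheory GRing.Theory Num.Theory.

Local Open Scope classical_set_scope.
Local Open Scope ring_scope.

(** Take complex affixes with the origin at the centre of the circle and its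
    radius as unit of length, so that x^* = 1 / x for every point x of the
    circle. Two classical formulas then do the work.

    - The second intersection d' of the line dp with the circle satisfies
      d' (1 - d p^* ) = p - d [second_intersection_pt].
    - The isogonal conjugate q of p in the triangle abc inscribed in the circle
      satisfies p + q + a b c p^* q^* = a + b + c, which together with its
      conjugate gives
      q (1 - p p^* ) = s1 - p - s2 p^* + s3 p^* ^2,
      where the si are the elementary symmetric functions of a, b, c
      [isogonal_formula].

    Eliminating d from these expresses q as an affine function of d' whose two
    coefficients are symmetric in a, b, c, d
    [isogonal_conjugate_similarity]. The same map z |-> shift + ratio * z
    therefore sends A', B', C', D' to Pg1, Pg2, Pg3, Pg4. It is a direct
    similarity because
      ratio = (1 - a p^* ) (1 - b p^* ) (1 - c p^* ) (1 - d p^* ) / (1 - p p^* )^2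
    is nonzero when p is none of the four vertices.

    The formulas need p p^* <> 1, that is, P not on the circle. This is where the
    hyperbola enters: on the unit circle the equation of a conic becomes a
    polynomial equation of degree 4, whose leading coefficient is nonzero for a
    hyperbola, so that the circle and the hyperbola share at most four points
    [hyperbola_off_circle], and these are already A, B, C, D. *)

(** * Algebra on the unit circle *)

Lemma unit_circle_neq0 {C : numClosedFieldType} {x : C} : x * x^* = 1 -> x != 0.
Proof. by apply: contra_eq_neq => ->; rewrite mul0r eq_sym oner_neq0. Qed.

Lemma unit_circle_conj {C : numClosedFieldType} {x : C} :
  x * x^* = 1 -> x^* = x^-1.
Proof.
by move=> xx; rewrite -[LHS]mul1r -(mulVf (unit_circle_neq0 xx)) -mulrA xx mulr1.
Qed.

(** The realness hypothesis says that c, c' and p are collinear. *)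
Lemma second_point_of_chord (C : numClosedFieldType) (c c' p : C) :
  c * c^* = 1 -> c' * c'^* = 1 -> c' != c ->
  (c' - c) * (p - c)^* \is Num.real ->
  c' * (1 - c * p^*) = p - c.
Proof.
move=> cc cc' c'c /CrealP; rewrite !(rmorphB, rmorphM) /= !conjCK.
have c0 := unit_circle_neq0 cc; have c'0 := unit_circle_neq0 cc'.
rewrite (unit_circle_conj cc) (unit_circle_conj cc') => h.
apply/eqP; rewrite -subr_eq0.
have := subr_eq0 c' c; rewrite (negbTE c'c) => /negbT d0.
suff /eqP : (c' - c) / (c * c') * (c' * (1 - c * p^*) - (p - c)) = 0.
  by rewrite !mulf_eq0 invr_eq0 mulf_eq0 (negbTE d0) (negbTE c0) (negbTE c'0).
transitivity ((c'^-1 - c^-1) * (p - c) - (c' - c) * (p^* - c^-1)).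
  by field; rewrite c0 c'0.
by rewrite h subrr.
Qed.

(** The realness hypothesis says that the lines xp and xq are isogonal at x: the
    sum of their arguments is, modulo pi, that of the arguments of the sides xy
    and xz. The equation vanishing at the isogonal conjugate is
    N = p + q + x y z p^* q^* - (x + y + z), and one vertex only gives that N is a
    multiple of its conjugate, with a factor depending on the vertex. *)
Lemma isogonal_vertex (C : numClosedFieldType) (x y z p q : C) :
  x * x^* = 1 -> y * y^* = 1 -> z * z^* = 1 -> y != x -> z != x ->
  (q - x) * (p - x) * ((y - x) * (z - x))^* \is Num.real ->
  p + q + x * y * z * p^* * q^* - (x + y + z) =
  y * z * (p + q + x * y * z * p^* * q^* - (x + y + z))^*.
Proof.
move=> xx yy zz yx zx /CrealP; rewrite !(rmorphB, rmorphM) /= !conjCK.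
have x0 := unit_circle_neq0 xx; have y0 := unit_circle_neq0 yy.
have z0 := unit_circle_neq0 zz.
rewrite !(rmorphB, rmorphD, rmorphM) /= !conjCK.
rewrite (unit_circle_conj xx) (unit_circle_conj yy).
rewrite (unit_circle_conj zz) => h.
rewrite -subr_eq0 in yx; rewrite -subr_eq0 in zx.
have k0 : (y - x) * (z - x) / (x * y * z) != 0.
  by rewrite !mulf_neq0 ?invr_neq0 ?mulf_neq0.
apply: (mulfI k0); apply/eqP; rewrite -subr_eq0; apply/eqP.
transitivity ((q^* - x^-1) * (p^* - x^-1) * ((y - x) * (z - x)) -
   (q - x) * (p - x) * ((y^-1 - x^-1) * (z^-1 - x^-1))).
  by field; rewrite x0 y0 z0.
by rewrite h subrr.
Qed.

(** Two vertices give N = y z N^* = z x N^* in the notation of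
    [isogonal_vertex], hence N = 0; the combination N - x y z p^* N^* then
    eliminates q^*. *)
Lemma isogonal_formula (C : numClosedFieldType) (x y z p q : C) :
  x * x^* = 1 -> y * y^* = 1 -> z * z^* = 1 -> x != y -> y != z -> z != x ->
  (q - x) * (p - x) * ((y - x) * (z - x))^* \is Num.real ->
  (q - y) * (p - y) * ((z - y) * (x - y))^* \is Num.real ->
  q * (1 - p * p^*) =
  x + y + z - p - (x * y + y * z + z * x) * p^* + x * y * z * p^* ^+ 2.
Proof.
move=> xx yy zz xy yz zx hx hy.
have yx : y != x by rewrite eq_sym.
have zy : z != y by rewrite eq_sym.
have Nx := isogonal_vertex _ _ _ _ _ _ xx yy zz yx zx hx.
have Ny := isogonal_vertex _ _ _ _ _ _ yy zz xx zy xy hy.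
have x0 := unit_circle_neq0 xx; have y0 := unit_circle_neq0 yy.
have z0 := unit_circle_neq0 zz.
set N := _ + _ - _ in Nx.
have eN : p + q + y * z * x * p^* * q^* - (y + z + x) = N by rewrite /N; ring.
rewrite eN in Ny.
have N'0 : N^* = 0.
  have /eqP : (y - x) * z * N^* = 0.
    transitivity (y * z * N^* - z * x * N^*); first by ring.
    by rewrite -Nx -Ny subrr.
  by rewrite !mulf_eq0 subr_eq0 (negbTE yx) (negbTE z0) /= => /eqP.
have N0 : N = 0 by rewrite Nx N'0 mulr0.
move: N'0; rewrite /N !(rmorphB, rmorphD, rmorphM) /= !conjCK.
rewrite (unit_circle_conj xx) (unit_circle_conj yy).
rewrite (unit_circle_conj zz) => N'0.
apply/eqP; rewrite -subr_eq0; apply/eqP.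
transitivity (N - x * y * z * p^* *
  (p^* + q^* + x^-1 * y^-1 * z^-1 * p * q - (x^-1 + y^-1 + z^-1))).
  by rewrite /N; field; rewrite x0 y0 z0.
by rewrite N'0 N0 mulr0 subrr.
Qed.

Definition similarity_ratio {C : numClosedFieldType} (a b c d p : C) : C :=
  (1 - a * p^*) * (1 - b * p^*) * (1 - c * p^*) * (1 - d * p^*)
  / (1 - p * p^*) ^+ 2.

(** Apart from the terms in p alone, the numerator is the alternating sum of the
    elementary symmetric functions of a, b, c, d against powers of p^*; only the
    symmetry in a, b, c, d matters, since it makes the four vertices share one
    map. *)
Definition similarity_shift {C : numClosedFieldType} (a b c d p : C) : C :=
  (a + b + c + d - 2 * p + p ^+ 2 * p^*
   - (a * b + a * c + a * d + b * c + b * d + c * d) * p^*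
   + (a * b * c + a * b * d + a * c * d + b * c * d) * p^* ^+ 2
   - a * b * c * d * p^* ^+ 3) / (1 - p * p^*) ^+ 2.

Lemma isogonal_conjugate_similarity (C : numClosedFieldType) (a b c d p q d' : C) :
  1 - p * p^* != 0 -> 1 - d * p^* != 0 ->
  q * (1 - p * p^*) =
  a + b + c - p - (a * b + b * c + c * a) * p^* + a * b * c * p^* ^+ 2 ->
  d' * (1 - d * p^*) = p - d ->
  q = similarity_shift a b c d p + similarity_ratio a b c d p * d'.
Proof.
move=> w0 d0 qE dE; have -> : d' = (p - d) / (1 - d * p^*) by rewrite -dE mulfK.
apply: (mulIf w0); rewrite qE /similarity_shift /similarity_ratio.
by field; rewrite d0 w0.
Qed.

(** * A conic through five points of the unit circle *)

(** Multiplied by z^2, the equation becomes a polynomial equation of degree at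
    most 4 on the unit circle, where z^* = 1 / z; with five roots it is zero.
    The term in z z^* of a general conic is constant there, so that it belongs
    to gamma. *)
Lemma five_points_on_conic (C : numClosedFieldType)
    (alpha beta gamma beta' alpha' : C) (s : seq C) :
  uniq s -> (4 < size s)%N -> (forall z, z \in s -> z * z^* = 1) ->
  (forall z, z \in s ->
     alpha * z ^+ 2 + beta * z + gamma + beta' * z^* + alpha' * z^* ^+ 2 = 0) ->
  alpha = 0.
Proof.
move=> us ss uc hs.
pose Q := Poly [:: alpha'; beta'; gamma; beta; alpha].
have sQ : (size Q <= 5)%N by exact: size_Poly.
have rQ : all (root Q) s.
  apply/allP => z zs; apply/rootP; rewrite horner_Poly /=.
  have z0 := unit_circle_neq0 (uc z zs).
  have := hs z zs; rewrite (unit_circle_conj (uc z zs)) => h.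
  transitivity (z ^+ 2 * (alpha * z ^+ 2 + beta * z + gamma + beta' * z^-1
                          + alpha' * z^-1 ^+ 2)).
    by field.
  by rewrite h mulr0.
have [Q0|Qn0] := eqVneq Q 0.
  have := coef_Poly [:: alpha'; beta'; gamma; beta; alpha] 4.
  by rewrite -/Q Q0 coef0.
by have := leq_trans (leq_ltn_trans ss (max_poly_roots Qn0 rQ us)) sQ.
Qed.

(** This is the shape that the canonical equation of a hyperbola takes in
    complex coordinates; U^2 - V^2 is the coefficient of z^2. *)
Lemma conic_difference_of_squares (C : numClosedFieldType)
    (U U' k V V' l : C) (s : seq C) :
  uniq s -> (4 < size s)%N -> (forall z, z \in s -> z * z^* = 1) ->
  (forall z, z \in s ->
     (U * z + U' * z^* + k) ^+ 2 - (V * z + V' * z^* + l) ^+ 2 = 1) ->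
  U ^+ 2 = V ^+ 2.
Proof.
move=> us ss uc hs; apply/eqP; rewrite -subr_eq0; apply/eqP.
apply: (@five_points_on_conic C _ (2 * (U * k - V * l))
  (2 * (U * U' - V * V') + k ^+ 2 - l ^+ 2 - 1)
  (2 * (U' * k - V' * l)) (U' ^+ 2 - V' ^+ 2) s) => // z zs.
rewrite -[RHS](subrr 1) -[in RHS](hs z zs).
transitivity ((U * z + U' * z^* + k) ^+ 2 - (V * z + V' * z^* + l) ^+ 2 - 1 +
   2 * (U * U' - V * V') * (1 - z * z^*)); first by ring.
by rewrite uc // hs // !subrr mulr0 addr0.
Qed.

(** * Complex affixes of plane vectors *)

Lemma real_complex_real {R : realType} (k : R) : real_complex R k \is Num.real.
Proof. by apply/complex_realP; exists k. Qed.

Lemma conj_real_complex {R : realType} (k : R) :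
  (real_complex R k)^* = real_complex R k.
Proof. by apply/CrealP; exact: real_complex_real. Qed.

Definition affix {R : realType} (v : 'rV[R]_2) : R[i] := Complex (v 0 0) (v 0 1).

Lemma affixD {R : realType} (v w : 'rV[R]_2) : affix (v + w) = affix v + affix w.
Proof. by rewrite /affix !mxE. Qed.

Lemma affixB {R : realType} (v w : 'rV[R]_2) : affix (v - w) = affix v - affix w.
Proof. by rewrite /affix !mxE. Qed.

Lemma affixZ {R : realType} (k : R) (v : 'rV[R]_2) :
  affix (k *: v) = real_complex R k * affix v.
Proof.
by rewrite /affix !mxE; apply/eqP; rewrite eq_complex /= !mul0r subr0 addr0 !eqxx.
Qed.

Lemma affix_inj {R : realType} : injective (@affix R).
Proof.
move=> v w [e0 e1]; apply/rowP => i.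
case: (unliftP 0 i) => [j|] ->; rewrite ?ord1 //.
by rewrite (_ : lift 0 0 = 1) //; apply/val_inj.
Qed.

Lemma affix_eq0 {R : realType} (v : 'rV[R]_2) : (affix v == 0) = (v == 0).
Proof.
apply/eqP/eqP => [v0|->]; last by rewrite /affix !mxE.
by apply: affix_inj; rewrite v0 /affix !mxE.
Qed.

Lemma dotE {R : realType} (v w : 'rV[R]_2) :
  dot v w = v 0 0 * w 0 0 + v 0 1 * w 0 1.
Proof. by rewrite /dot big_ord_recl big_ord1 /=; do !f_equal; apply/val_inj. Qed.

Lemma dot_affix {R : realType} (v w : 'rV[R]_2) :
  real_complex R (dot v w) =
  (affix v * (affix w)^* + (affix v)^* * affix w) / 2.
Proof.
have e2 : (2 : R[i]) != 0 by rewrite pnatr_eq0.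
apply: (mulIf e2); rewrite divfK // dotE.
by apply/eqP; rewrite eq_complex /=; apply/andP; split; apply/eqP; ring.
Qed.

Lemma dot_self_affix {R : realType} (v : 'rV[R]_2) :
  real_complex R (dot v v) = affix v * (affix v)^*.
Proof.
have e2 : (2 : R[i]) != 0 by rewrite pnatr_eq0.
by rewrite dot_affix; apply: (mulIf e2); rewrite divfK //; ring.
Qed.

Lemma enorm_affix {R : realType} (v : 'rV[R]_2) :
  real_complex R (enorm v) = `|affix v|.
Proof. by rewrite normc_def /enorm dotE. Qed.

(** A reflection is z |-> e^(2 i theta) z^* for an axis of argument theta, and
    d / d^* = e^(2 i theta) for any d directing the axis. *)
Lemma reflection_affix {R : realType} (X d M : 'rV[R]_2) :
  d != 0 -> affix (reflection X d M - X) =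
  affix d / (affix d)^* * (affix (M - X))^*.
Proof.
rewrite -affix_eq0 => a0.
have b0 : (affix d)^* != 0 by rewrite conjC_eq0.
have -> : reflection X d M - X = (2 * dot (M - X) d / dot d d) *: d - (M - X).
  by rewrite /reflection -(addrA X) [X + (_ - _)]addrC addrK.
rewrite [LHS]affixB affixZ rmorphM fmorphV rmorphM rmorph_nat /=.
by rewrite dot_self_affix dot_affix; field; rewrite a0 b0.
Qed.

(** * Geometry in the coordinates of the circle *)

Definition pt {R : realType} (O : 'rV[R]_2) (r : R) (X : 'rV[R]_2) : R[i] :=
  affix (r^-1 *: (X - O)).

Section CircleCoordinates.
Context {R : realType} {O : 'rV[R]_2} {r : R} (r0 : 0 < r).
Implicit Types X Y Z P Q S M : 'rV[R]_2.

Let rC0 : real_complex R r != 0.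
Proof. by rewrite fmorph_eq0 lt0r_neq0. Qed.

Lemma ptB X Y : affix (Y - X) = real_complex R r * (pt O r Y - pt O r X).
Proof.
rewrite /pt -affixB -scalerBr affixZ fmorphV mulrA mulfV // mul1r.
by congr affix; rewrite opprB addrA subrK.
Qed.

Lemma edist_pt X Y :
  real_complex R (edist X Y) = real_complex R r * `|pt O r Y - pt O r X|.
Proof.
rewrite /edist enorm_affix ptB normrM; congr (_ * _).
by apply: ger0_norm; rewrite ler0c ltW.
Qed.

Lemma pt_inj : injective (pt O r).
Proof.
move=> X Y e; apply: (addIr (- X)); apply: affix_inj.
by rewrite !ptB e !subrr.
Qed.

Lemma ptE X : affix (X - O) = real_complex R r * pt O r X.
Proof.
have pO : pt O r O = 0 by rewrite /pt subrr scaler0 /affix !mxE.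
by rewrite ptB pO subr0.
Qed.

Lemma circle_pt {X} : circle O r X -> pt O r X * (pt O r X)^* = 1.
Proof.
rewrite -normCK /circle /= /edist => e.
have : `|affix (X - O)| = real_complex R r by rewrite -enorm_affix e.
rewrite ptE normrM ger0_norm ?ler0c ?ltW // -[RHS]mulr1.
by move/(mulfI rC0) ->; rewrite expr1n.
Qed.

Lemma circle_pt_off {X P} :
  circle O r X -> P != X -> 1 - pt O r X * (pt O r P)^* != 0.
Proof.
move=> /circle_pt xx PX.
rewrite -xx -mulrBr -rmorphB mulf_neq0 ?conjC_eq0 ?(unit_circle_neq0 xx) //.
by rewrite subr_eq0 eq_sym; apply: contra_neq PX => /pt_inj.
Qed.

Lemma ptD_line X P (t : R) :
  pt O r (X + t *: (P - X)) - pt O r X =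
  real_complex R t * (pt O r P - pt O r X).
Proof.
apply: (mulfI rC0); rewrite mulrCA -!ptB -affixZ; congr affix.
by rewrite addrC addKr.
Qed.

Lemma second_intersection_pt S P S' :
  circle O r S -> P != S -> second_intersection (circle O r) S P S' ->
  pt O r S' * (1 - pt O r S * (pt O r P)^*) = pt O r P - pt O r S.
Proof.
move=> Sc PS [[t S'E] S'c S'S].
have cc := circle_pt Sc; have cc' := circle_pt S'c.
case: S'S => [S'S|[S'S tang]].
  apply: second_point_of_chord => //; first by apply: contra_notN S'S => /eqP/pt_inj.
  rewrite S'E ptD_line -mulrA -normCK rpredM ?rpredX ?normr_real //.
  exact: real_complex_real.
(* M is the point where the line meets the circle again, the second root of
   the quadratic equation for the parameter; tangency forces M = S, that is,
   the radius OS is orthogonal to SP. *)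
pose n := dot (P - S) (P - S); pose m := dot (S - O) (P - S).
pose M := S + (- (2 * m) / n) *: (P - S).
have n0 : n != 0.
  rewrite /n -(fmorph_eq0 (real_complex R)) /= dot_self_affix mul_conjC_eq0.
  by rewrite affix_eq0 subr_eq0.
have MS : M = S.
  suff : (line_through S P `&` circle O r) M by rewrite tang.
  split; first by exists (- (2 * m) / n).
  rewrite /circle /= -[RHS]Sc /edist /enorm; congr Num.sqrt.
  transitivity (dot (S - O) (S - O) + 2 * (- (2 * m) / n) * m
                + (- (2 * m) / n) ^+ 2 * n).
    rewrite /M; set t1 := - _ / _; rewrite /m /n !dotE !mxE; ring.
  by field.
have m0 : m = 0.
  have /eqP : (- (2 * m) / n) *: (P - S) = 0 by apply: (addrI S); rewrite addr0.
  rewrite scaler_eq0 subr_eq0 (negbTE PS) orbF mulf_eq0 invr_eq0 (negbTE n0) orbF.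
  by rewrite oppr_eq0 mulf_eq0 pnatr_eq0 => /eqP.
have := dot_affix (S - O) (P - S); rewrite -/m m0 rmorph0 ptE ptB S'S.
move: cc rC0; set c := pt O r S; set p := pt O r P.
set k := real_complex R r => cc k0 h.
have c0 := unit_circle_neq0 cc.
apply/eqP; rewrite -subr_eq0; apply/eqP.
transitivity (- c * 2 / (k * k) *
   ((k * c * (k * (p - c))^* + (k * c)^* * (k * (p - c))) / 2));
  last by rewrite -h mulr0.
rewrite !rmorphM rmorphB /= conj_real_complex -/k (unit_circle_conj cc).
by field; rewrite k0 c0.
Qed.

(** The bisector is directed by the sum of the unit vectors e1 and e2 along the
    sides, and (e1 + e2) / (e1 + e2)^* = e1 e2. Hence reflecting the line XP gives
    q - x = t e1 e2 (p - x)^* with t real. *)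
Lemma isogonal_line_pt X Y Z P Q :
  circle O r X -> circle O r Y -> circle O r Z ->
  Y != X -> Z != X -> Y != Z ->
  isogonal_line X Y Z P Q ->
  (pt O r Q - pt O r X) * (pt O r P - pt O r X) *
    ((pt O r Y - pt O r X) * (pt O r Z - pt O r X))^* \is Num.real.
Proof.
move=> Xc Yc Zc YX ZX YZ [M [t ME] QE].
set x := pt O r X; set y := pt O r Y; set z := pt O r Z.
set p := pt O r P; set q := pt O r Q.
have xx := circle_pt Xc; have yy := circle_pt Yc; have zz := circle_pt Zc.
have nz (U V : 'rV[R]_2) : U != V -> pt O r U - pt O r V != 0.
  by rewrite subr_eq0; apply: contra_neq => /pt_inj.
have yx := nz _ _ YX; have zx := nz _ _ ZX.
pose unitv (U V : 'rV[R]_2) := affix ((edist U V)^-1 *: (V - U)).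
have unitvE (U V : 'rV[R]_2) :
    unitv U V = (pt O r V - pt O r U) / `|pt O r V - pt O r U|.
  rewrite /unitv affixZ fmorphV /= edist_pt ptB invfM mulrACA mulVf // mul1r.
  by rewrite mulrC.
have unitv1 (U V : 'rV[R]_2) : V != U -> unitv U V * (unitv U V)^* = 1.
  move=> /nz VU; rewrite -normCK unitvE normrM normfV normr_id divff ?expr1n //.
  by rewrite normr_eq0.
have dE : affix (bisector_dir X Y Z) = unitv X Y + unitv X Z by rewrite affixD.
(* If the unit vectors were opposite, Y would be on the line XZ, hence the
   second point of the chord from X through Z, which is Z. *)
have d0 : bisector_dir X Y Z != 0.
  apply/eqP => d0; case/negP: YZ; apply/eqP/pt_inj; rewrite -/y -/z.
  have e : y - x = - (`|y - x| / `|z - x|) * (z - x).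
    have s0 : (y - x) / `|y - x| + (z - x) / `|z - x| = 0.
      by rewrite -!unitvE -dE d0 /affix !mxE.
    have ny : `|y - x| != 0 by rewrite normr_eq0.
    have nz' : `|z - x| != 0 by rewrite normr_eq0.
    transitivity (`|y - x| * ((y - x) / `|y - x| + (z - x) / `|z - x|)
      - `|y - x| / `|z - x| * (z - x)); first by field; rewrite ny nz'.
    by rewrite s0 mulr0 sub0r mulNr.
  have : y * (1 - x * z^*) = z - x.
    apply: second_point_of_chord => //; first by rewrite -subr_eq0.
    rewrite e -mulrA -normCK; apply: rpredM; last by rewrite rpredX ?normr_real.
    by rewrite rpredN rpred_div ?normr_real.
  rewrite (unit_circle_conj zz) => h; apply: (mulIf zx); rewrite -/x -/z.
  transitivity (z * (y * (1 - x * z^-1))); last by rewrite h.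
  by field; exact: unit_circle_neq0 zz.
have MX : M - X = t *: (P - X) by rewrite ME addrC addKr.
have := reflection_affix X _ M d0; rewrite QE MX affixZ dE !ptB.
have := unitv1 X Y YX; have := unitv1 X Z ZX.
have yE : y - x = unitv X Y * `|y - x| by rewrite unitvE divfK // normr_eq0.
have zE : z - x = unitv X Z * `|z - x| by rewrite unitvE divfK // normr_eq0.
have dn0 : unitv X Y + unitv X Z != 0 by rewrite -dE affix_eq0.
rewrite yE zE; move: (unitv X Y) (unitv X Z) dn0 => e1 e2 dn0 u2 u1.
rewrite -/x -/p -/q => h.
have qE : q - x = e1 * e2 * real_complex R t * (p - x)^*.
  apply: (mulfI rC0); rewrite h !rmorphM rmorphD /= !conj_real_complex.
  rewrite (unit_circle_conj u1) (unit_circle_conj u2).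
  have e10 := unit_circle_neq0 u1; have e20 := unit_circle_neq0 u2.
  by field; rewrite e10 e20 addrC dn0.
have -> : (q - x) * (p - x) * (e1 * `|y - x| * (e2 * `|z - x|))^* =
  real_complex R t * ((p - x) * (p - x)^*) * `|y - x| * `|z - x|.
  rewrite qE !rmorphM /=.
  rewrite (CrealP (normr_real (y - x))) (CrealP (normr_real (z - x))).
  transitivity ((e1 * e1^*) * (e2 * e2^*) *
   (real_complex R t * ((p - x) * (p - x)^*) * `|y - x| * `|z - x|)); first by ring.
  by rewrite u1 u2 !mul1r.
by rewrite -normCK !rpredM ?rpredX ?normr_real // real_complex_real.
Qed.

Lemma isogonal_conjugate_image {A B C D P Q D' : 'rV[R]_2} :
  A != B -> B != C -> C != A ->
  circle O r A -> circle O r B -> circle O r C -> circle O r D ->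
  P != D -> 1 - pt O r P * (pt O r P)^* != 0 ->
  isogonal_conjugate A B C P Q -> second_intersection (circle O r) D P D' ->
  pt O r Q =
  similarity_shift (pt O r A) (pt O r B) (pt O r C) (pt O r D) (pt O r P) +
  similarity_ratio (pt O r A) (pt O r B) (pt O r C) (pt O r D) (pt O r P)
  * pt O r D'.
Proof.
move=> AB BC CA Ac Bc Cc Dc PD w0 [QA QB _] D'E.
have BA : B != A by rewrite eq_sym.
have CB : C != B by rewrite eq_sym.
have ptn U V : U != V -> pt O r U != pt O r V by apply: contra_neq => /pt_inj.
apply: isogonal_conjugate_similarity => //.
- exact: circle_pt_off.
- apply: isogonal_formula; rewrite ?circle_pt ?ptn //.
  + exact: isogonal_line_pt QA.
  + exact: isogonal_line_pt QB.
- exact: second_intersection_pt.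
Qed.

(** For orthonormal u, v one has v^2 = - u^2 as complex numbers, so that the
    coefficient of z^2 in the canonical equation is a nonzero multiple of
    1 / a^2 + 1 / b^2. A conic with nonzero coefficient of z^2 does not
    contain five points of the circle. *)
Lemma hyperbola_off_circle (Sigma : set 'rV[R]_2) (s : seq 'rV[R]_2) :
  hyperbola Sigma -> uniq s -> (4 < size s)%N ->
  (forall M, M \in s -> Sigma M) ->
  ~ (forall M, M \in s -> pt O r M * (pt O r M)^* = 1).
Proof.
move=> [O' [u [v [a [b [[u1 v1 uv] [a0 b0 ->]]]]]]] us ss hs uc.
pose k := real_complex R r; pose dl := affix (O - O').
have ptP M : affix (M - O') = k * pt O r M + dl.
  by rewrite -ptE // -affixD addrA subrK.
have dotC w c M : real_complex R (dot (M - O') w / c) =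
  k * (affix w)^* / (2 * real_complex R c) * pt O r M +
  k * affix w / (2 * real_complex R c) * (pt O r M)^* +
  (dl * (affix w)^* + dl^* * affix w) / (2 * real_complex R c).
  rewrite rmorphM fmorphV /= dot_affix ptP rmorphD rmorphM /= conj_real_complex.
  by rewrite -/k invfM; ring.
have us' : uniq (map (pt O r) s) by rewrite map_inj_uniq //; exact: pt_inj.
have := @conic_difference_of_squares _
  (k * (affix u)^* / (2 * real_complex R a)) (k * affix u / (2 * real_complex R a))
  ((dl * (affix u)^* + dl^* * affix u) / (2 * real_complex R a))
  (k * (affix v)^* / (2 * real_complex R b)) (k * affix v / (2 * real_complex R b))
  ((dl * (affix v)^* + dl^* * affix v) / (2 * real_complex R b))
  (map (pt O r) s) us'.
rewrite size_map => /(_ ss) UV.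
have {UV} : (k * (affix u)^* / (2 * real_complex R a)) ^+ 2 =
            (k * (affix v)^* / (2 * real_complex R b)) ^+ 2.
  apply: UV => z /mapP[M Ms ->]; first exact: uc.
  rewrite -!dotC -!rmorphXn -rmorphB /=; have -> := hs M Ms.
  by rewrite rmorph1.
have := congr1 (real_complex R) u1; have := congr1 (real_complex R) uv.
rewrite dot_self_affix dot_affix rmorph0 rmorph1.
have ca0 : real_complex R a != 0 by rewrite fmorph_eq0 lt0r_neq0.
have cb0 : real_complex R b != 0 by rewrite fmorph_eq0 lt0r_neq0.
have := congr1 (real_complex R) v1; rewrite dot_self_affix rmorph1.
set U := affix u; set V := affix v => VV UV UU h.
have ab0 : a ^+ 2 + b ^+ 2 != 0.
  by rewrite lt0r_neq0 // addr_gt0 // exprn_gt0.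
case/negP: ab0; rewrite -(fmorph_eq0 (real_complex R)) rmorphD !rmorphXn /=.
move: ca0 cb0 h; set ca := real_complex R a; set cb := real_complex R b => ca0 cb0 h.
have U0 := unit_circle_neq0 UU; have V0 := unit_circle_neq0 VV.
move: UV h; rewrite (unit_circle_conj UU) (unit_circle_conj VV) => UV h.
suff : U ^- 2 * (ca ^+ 2 + cb ^+ 2) = 0.
  by move/eqP; rewrite mulf_eq0 invr_eq0 expf_eq0 (negbTE U0).
transitivity (4 * ca ^+ 2 * cb ^+ 2 / k ^+ 2 *
    ((k / U / (2 * ca)) ^+ 2 - (k / V / (2 * cb)) ^+ 2)
  + 2 * ca ^+ 2 / (U * V) * ((U / V + U^-1 * V) / 2)).
  by field; rewrite rC0 ca0 cb0 U0 V0.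
by rewrite h UV subrr !mulr0 addr0.
Qed.

Lemma affine_image_similar (n : nat) (V W : n.-tuple 'rV[R]_2) (shift ratio : R[i]) :
  ratio != 0 ->
  (forall i, pt O r (tnth V i) = shift + ratio * pt O r (tnth W i)) ->
  similar_polygons V W.
Proof.
move=> ratio0 VW.
have kE : real_complex R (complex.Re `|ratio|) = `|ratio|.
  by rewrite RRe_real ?normr_real.
exists (complex.Re `|ratio|); first by rewrite -ltcR kE normr_gt0.
move=> i j; apply: complexI; rewrite rmorphM /= kE !edist_pt !VW.
rewrite opprD addrACA subrr add0r -mulrBr normrM; ring.
Qed.

End CircleCoordinates.

Theorem theorem3 (R : realType) (O : 'rV[R]_2) (r : R)
    (A B C D P A' B' C' D' Pg1 Pg2 Pg3 Pg4 : 'rV[R]_2)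
    (Sigma : set 'rV[R]_2)
    (r_gt0 : 0 < r)
    (ABCD_distinct : uniq [:: A; B; C; D])
    (A_on_Gamma : circle O r A) (B_on_Gamma : circle O r B)
    (C_on_Gamma : circle O r C) (D_on_Gamma : circle O r D)
    (Sigma_hyp : rectangular_hyperbola Sigma)
    (A_on_Sigma : Sigma A) (B_on_Sigma : Sigma B)
    (C_on_Sigma : Sigma C) (D_on_Sigma : Sigma D)
    (P_on_Sigma : Sigma P) (P_notin : P \notin [:: A; B; C; D])
    (A'_second : second_intersection (circle O r) A P A')
    (B'_second : second_intersection (circle O r) B P B')
    (C'_second : second_intersection (circle O r) C P C')
    (D'_second : second_intersection (circle O r) D P D')
    (Pg1_conj : isogonal_conjugate B C D P Pg1)
    (Pg2_conj : isogonal_conjugate A C D P Pg2)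
    (Pg3_conj : isogonal_conjugate A B D P Pg3)
    (Pg4_conj : isogonal_conjugate A B C P Pg4) :
  similar_polygons [tuple Pg1; Pg2; Pg3; Pg4] [tuple A'; B'; C'; D'].
Proof.
have w0 : 1 - pt O r P * (pt O r P)^* != 0.
  apply/eqP => /eqP; rewrite subr_eq0 eq_sym => /eqP pp.
  apply: (@hyperbola_off_circle R O r r_gt0 Sigma [:: P; A; B; C; D]) => //.
  - by case: Sigma_hyp.
  - by rewrite cons_uniq P_notin.
  - by move=> M; rewrite !inE => /or4P[| | |/orP[]] /eqP ->.
  - by move=> M; rewrite !inE => /or4P[| | |/orP[]] /eqP -> //; exact: circle_pt.
move: ABCD_distinct; rewrite /= !inE !negb_or !andbT.
case/and3P => /and3P[AB AC AD] /andP[BC BD] CD.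
have [BA CA DA] : [/\ B != A, C != A & D != A] by split; rewrite eq_sym.
have [CB DB DC] : [/\ C != B, D != B & D != C] by split; rewrite eq_sym.
move: P_notin; rewrite !inE !negb_or => /and4P[PA PB PC PD].
have e1 := isogonal_conjugate_image r_gt0 BC CD DB B_on_Gamma C_on_Gamma
  D_on_Gamma A_on_Gamma PA w0 Pg1_conj A'_second.
have e2 := isogonal_conjugate_image r_gt0 AC CD DA A_on_Gamma C_on_Gamma
  D_on_Gamma B_on_Gamma PB w0 Pg2_conj B'_second.
have e3 := isogonal_conjugate_image r_gt0 AB BD DA A_on_Gamma B_on_Gamma
  D_on_Gamma C_on_Gamma PC w0 Pg3_conj C'_second.
have e4 := isogonal_conjugate_image r_gt0 AB BC CA A_on_Gamma B_on_Gamma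
  C_on_Gamma D_on_Gamma PD w0 Pg4_conj D'_second.
apply: (@affine_image_similar R O r r_gt0 _ _ _
  (similarity_shift (pt O r A) (pt O r B) (pt O r C) (pt O r D) (pt O r P))
  (similarity_ratio (pt O r A) (pt O r B) (pt O r C) (pt O r D) (pt O r P))).
  rewrite /similarity_ratio; apply: mulf_neq0; last by rewrite invr_neq0 ?expf_neq0.
  by do 3?[apply: mulf_neq0]; apply: circle_pt_off.
(* Pg4 is e4 as it stands; the others need the symmetry of the coefficients. *)
move=> i; rewrite !(tnth_nth 0); case: i => [[|[|[|[|i]]]] //= _].
- rewrite e1 /similarity_shift /similarity_ratio; ring.
- rewrite e2 /similarity_shift /similarity_ratio; ring.
- rewrite e3 /similarity_shift /similarity_ratio; ring.
Qed.
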